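(* Let $A, B \subset \mathbb{N}$ be infinite sets such that $s_A = \infty$ and $d_{A,B} = \infty$. Then, as $x \to \infty$, $$\max\Big\{1, \frac{s_A(x - 2d_{A,B}(x))}{d_{A,B}(x)}\Big\} \ll s_B(x) \ll s_A(x + 2d_{A,B}(x))\, d_{A,B}(x).$$
   Context: $\mathbb{N}$ denotes the set of nonnegative integers. For infinite sets $A = \{a_1 < a_2 < \cdots\}$, $B = \{b_1 < b_2 < \cdots\}$ of nonnegative integers, enumerated increasingly: $R_A(n)$ is the number of pairs $(i,j)$ with $i \le j$ and $a_i + a_j = n$; $s_A(x) = \max_{n \le x} R_A(n)$, the maximum being over $n \in \mathbb{N}$ with $n\le x$ and taken to be $0$ if $x<0$, and $s_A = \lim_{x\to\infty} s_A(x) \in \mathbb{N}\cup\{\infty\}$ (similarly for $B$); $d_{A,B}(x) = \max\{|a_t - b_t| : a_t \le x \text{ or } b_t \le x\}$ and $d_{A,B} = \lim_{x\to\infty} d_{A,B}(x) \in \mathbb{N}\cup\{\infty\}$. $f \ll g$ means $f = O(g)$. *)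

(* Defs.v *)
From mathcomp Require Export all_boot all_order all_algebra finmap.
From mathcomp Require Export all_classical all_reals all_analysis.
Export numFieldNormedType.Exports.
Export Order.TTheory GRing.Theory Num.Theory.

Set Implicit Arguments.
Unset Strict Implicit.
Unset Printing Implicit Defensive.

Local Open Scope classical_set_scope.
Local Open Scope ring_scope.

(* The strictly increasing a : nat -> nat with range A, indexed from 0: the
   element a_t of the usual 1-based numbering is [increasing_enum A t.-1].
   It is characterized by increasing_enumP when A is infinite, and is a junk
   value otherwise. *)
Definition increasing_enum (A : set nat) : nat -> nat :=
  [get a : nat -> nat | {homo a : i j / (i < j)%N} /\ range a = A].

Lemma increasing_enumP (A : set nat) : infinite_set A ->
  {homo increasing_enum A : i j / (i < j)%N} /\ range (increasing_enum A) = A.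
Proof.
move=> Ainf.
suff [a aP] : exists a : nat -> nat,
    {homo a : i j / (i < j)%N} /\ range a = A.
  rewrite /increasing_enum; case: xgetP => [b _ [] //|h]; by case: (h a).
have ex n : exists m, `[< A m >] && (n <= m)%N.
  apply: contrapT => h; apply: Ainf.
  apply: (@sub_finite_set _ _ `I_n); last exact: finite_II.
  move=> m Am /=; rewrite ltnNge; apply/negP => nm; apply: h; exists m.
  by rewrite nm andbT; apply/asboolP.
pose next n := ex_minn (ex n).
have nextA n : A (next n).
  by rewrite /next; case: ex_minnP => m /andP[/asboolP].
have next_ge n : (n <= next n)%N.
  by rewrite /next; case: ex_minnP => m /andP[].
have next_min n m : A m -> (n <= m)%N -> (next n <= m)%N.
  move=> Am nm; rewrite /next; case: ex_minnP => k _; apply.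
  by rewrite nm andbT; apply/asboolP.
pose a := fix a n := if n is k.+1 then next (a k).+1 else next 0%N.
have ainc : {homo a : i j / (i < j)%N}.
  by apply: homo_ltn => [y x z|i]; [exact: ltn_trans | exact: next_ge].
have a_ge n : (n <= a n)%N.
  by elim: n => // n ih; apply: (leq_ltn_trans ih); apply: ainc.
exists a; split => //.
apply/seteqP; split=> [_ [[|n] _ <-]|m Am] /=; do ?exact: nextA.
have exm : exists n, (m <= a n)%N by exists m.
case: (ex_minnP exm) => n mn nmin; exists n => //.
apply/eqP; rewrite eqn_leq mn andbT.
case: n mn nmin => [|k] mn nmin; apply: next_min => //.
by rewrite ltnNge; apply/negP => /nmin; rewrite ltnn.
Qed.

(* R_A(n); the set is finite when A is infinite, since then i, j <= n. *)
Definition rep_count (A : set nat) (n : nat) : nat :=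
  let a := increasing_enum A in
  #|` fset_set [set p : nat * nat | (p.1 <= p.2)%N /\ (a p.1 + a p.2 = n)%N]|.

Definition max_rep (R : realType) (A : set nat) (x : R) : nat :=
  \big[maxn/0%N]_(n \in [set n : nat | n%:R <= x]) rep_count A n.

(* |m - n|%N is the absolute difference of natural numbers. The index set is
   finite when A and B are infinite; when it is empty, i.e. when x is smaller
   than both min A and min B, the maximum is taken to be 0. *)
Definition enum_dist (R : realType) (A B : set nat) (x : R) : nat :=
  let a := increasing_enum A in
  let b := increasing_enum B in
  \big[maxn/0%N]_(t \in [set t : nat | (a t)%:R <= x \/ (b t)%:R <= x])
    `|a t - b t|%N.

(* Lets the library's Landau notations be used at +oo. *)
Canonical pinfty_filterType (R : numFieldType) :=
  FilterType (pinfty_nbhs R) (@proper_pinfty_nbhs R).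

(* Main.v *)
Require Import Defs.
From mathcomp Require Import zify lra.

(** Write a, b for the increasing enumerations of A, B and D for
    d_{A,B}(x). If a_i + a_j = n and both terms are at most x, then
    b_i + b_j lies within 2D of n. So every pair of indices representing n
    by A represents, by B, one of the 4D + 1 integers in [n - 2D, n + 2D],
    and R_A(n) is at most the sum of R_B(m) over these m
    ([rep_count_perturb]). Taking maxima gives, for D >= 1,
      s_A(y) <= (4D + 1) s_B(y + 2D) <= 5 D s_B(y + 2D)
    as long as the terms of A up to y move by at most D
    ([max_rep_perturb]).

    Both bounds are instances of this inequality, with implied constant 5.
    For the lower bound, y = x - 2D, and the terms of A up to y are also at
    most x, where d_{A,B}(x) controls them; the 1 in the maximum is absorbed
    because s_B(x) >= 1 once x >= 2 b_1 ([max_rep_gt0]). For the upper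
    bound, A and B trade places and y = x. In both cases d_{A,B}(x) >= 1 for
    large x because d_{A,B} is infinite. *)

Local Open Scope classical_set_scope.
Local Open Scope ring_scope.

Lemma fsbig_maxn_sup (T : choiceType) (X : set T) (F : T -> nat) (t : T) :
  finite_set X -> X t -> (F t <= \big[maxn/0%N]_(i \in X) F i)%N.
Proof.
move=> Xfin Xt; rewrite fsbig_finite//.
by apply: leq_bigmax_seq => //; rewrite in_fset_set// inE.
Qed.

Lemma fsbig_maxn_le (T : choiceType) (X : set T) (F : T -> nat) (m : nat) :
  finite_set X -> (forall t, X t -> (F t <= m)%N) ->
  (\big[maxn/0%N]_(i \in X) F i <= m)%N.
Proof.
move=> Xfin Fm; rewrite fsbig_finite//.
by apply/bigmax_leqP_seq => t; rewrite in_fset_set// inE => /Fm.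
Qed.

Lemma leq_card_bigfcup (T I : choiceType) (r : seq I) (F : I -> {fset T}) :
  (#|` (\bigcup_(i <- r) F i)%fset| <= \sum_(i <- r) #|` F i|)%N.
Proof.
elim/big_rec2: _ => [|i m U _ IH]; first by rewrite cardfs0.
by apply: leq_trans (leq_card_fsetU _ _) _; rewrite leq_add2l.
Qed.

Lemma leq_increasing_enum (A : set nat) (n : nat) :
  infinite_set A -> (n <= increasing_enum A n)%N.
Proof.
move=> /increasing_enumP[homoA _].
by elim: n => // n IH; apply: leq_ltn_trans IH (homoA _ _ _).
Qed.

(** The set counted by [rep_count]: pairs of indices, so that a single pair
    can be read as a representation by A and by B at once. *)
Definition reps (A : set nat) (n : nat) : set (nat * nat) :=
  [set p | (p.1 <= p.2)%N /\
           (increasing_enum A p.1 + increasing_enum A p.2 = n)%N].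

Lemma finite_reps (A : set nat) (n : nat) :
  infinite_set A -> finite_set (reps A n).
Proof.
move=> Ainf; apply: (@sub_finite_set _ _ (`I_n.+1 `*` `I_n.+1)); last first.
  by apply: finite_setX; exact: finite_II.
move=> [i j] [_ /= ij].
have := leq_increasing_enum _ i Ainf; have := leq_increasing_enum _ j Ainf.
by move=> jb ib; split => /=; lia.
Qed.

Lemma finite_nat_le (R : realType) (x : R) : finite_set [set n : nat | n%:R <= x].
Proof.
have x_lt : x < (Num.truncn `|x|).+1%:R.
  by rewrite (le_lt_trans (ler_norm x))// truncnS_gt.
apply: (@sub_finite_set _ _ `I_(Num.truncn `|x|).+1); last exact: finite_II.
by move=> n /= /le_lt_trans -/(_ _ x_lt); rewrite ltr_nat.
Qed.

Lemma rep_count_le_max_rep (R : realType) (A : set nat) (n : nat) (x : R) :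
  n%:R <= x -> (rep_count A n <= max_rep A x)%N.
Proof. by move=> nx; apply: fsbig_maxn_sup => //; exact: finite_nat_le. Qed.

Lemma enum_distC (R : realType) (A B : set nat) (x : R) :
  enum_dist A B x = enum_dist B A x.
Proof.
rewrite /enum_dist; under eq_fsbigr do rewrite distnC.
by congr (\big[_/_]_(_ \in _) _); apply/seteqP; split=> t /= [];
  [right|left|right|left].
Qed.

Lemma enum_dist_ge (R : realType) (A B : set nat) (x : R) (t : nat) :
  infinite_set A -> infinite_set B -> (increasing_enum A t)%:R <= x ->
  (`|increasing_enum A t - increasing_enum B t| <= enum_dist A B x)%N.
Proof.
move=> Ainf Binf atx; apply: fsbig_maxn_sup; last by left.
(* Since t <= a_t and t <= b_t, every index in the range of the maximum is at
   most x. *)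
apply: sub_finite_set (finite_nat_le _ x) => u /= [] /(le_trans _); apply;
  by rewrite ler_nat leq_increasing_enum.
Qed.

(** Distinct pairs of indices stay distinct when A is replaced by B; only the
    represented integer changes, by at most 2D. Hence the representations of
    n by A are covered by those of 4D + 1 integers by B. *)
Lemma rep_count_perturb (A B : set nat) (n D M : nat) :
  infinite_set A -> infinite_set B ->
  (forall t, (increasing_enum A t <= n)%N ->
    (`|increasing_enum A t - increasing_enum B t| <= D)%N) ->
  (forall m, (m <= n + 2 * D)%N -> (rep_count B m <= M)%N) ->
  (rep_count A n <= (4 * D + 1) * M)%N.
Proof.
move=> Ainf Binf near_ab repB.
(* For n < 2D some of the n + k - 2D truncate to 0. The bound on R_B also
   holds there, so counting R_B(0) several times is harmless. *)
pose F k := fset_set (reps B (n + k - 2 * D)).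
have sub : (fset_set (reps A n) `<=` \bigcup_(k <- iota 0 (4 * D + 1)) F k)%fset.
  apply/fsubsetP => -[i j].
  rewrite in_fset_set ?inE; last exact: finite_reps.
  move=> -[/= ij aij].
  have ai : (increasing_enum A i <= n)%N by lia.
  have aj : (increasing_enum A j <= n)%N by lia.
  have := near_ab _ ai; have := near_ab _ aj => dj di.
  apply/bigfcupP.
  exists (increasing_enum B i + increasing_enum B j + 2 * D - n)%N.
    by rewrite mem_iota andbT; lia.
  rewrite in_fset_set ?inE; last exact: finite_reps.
  by split => //=; lia.
apply: leq_trans (fsubset_leq_card sub) _.
apply: leq_trans (leq_card_bigfcup _ _ _ _) _.
have -> : ((4 * D + 1) * M = \sum_(k <- iota 0 (4 * D + 1)) M)%N.
  by rewrite big_const_seq count_predT size_iota iter_addn_0 mulnC.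
rewrite big_seq [leqRHS]big_seq.
apply: leq_sum => k; rewrite mem_iota => kD.
by apply: repB; lia.
Qed.

(** The inequality behind both halves of the theorem. The condition 0 < D
    serves to replace the 4D + 1 of [rep_count_perturb] by 5D. *)
Lemma max_rep_perturb (R : realType) (A B : set nat) (x y : R) (D : nat) :
  infinite_set A -> infinite_set B -> (0 < D)%N ->
  (forall t, (increasing_enum A t)%:R <= y ->
    (`|increasing_enum A t - increasing_enum B t| <= D)%N) ->
  y + 2 * D%:R <= x ->
  (max_rep A y <= 5 * D * max_rep B x)%N.
Proof.
move=> Ainf Binf D_gt0 near_ab yx; apply: fsbig_maxn_le => [|n /= ny].
  exact: finite_nat_le.
apply: (@leq_trans ((4 * D + 1) * max_rep B x)); last first.
  by rewrite leq_mul2r; lia.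
apply: (rep_count_perturb _ _ _ _ _ Ainf Binf) => [t tn|m mn].
  by apply: near_ab; apply: le_trans ny; rewrite ler_nat.
apply: rep_count_le_max_rep; apply: le_trans yx.
apply: (@le_trans _ _ (n + 2 * D)%:R); first by rewrite ler_nat.
by rewrite natrD natrM lerD2r.
Qed.

(** The sum of the least element of B with itself is a representation. *)
Lemma max_rep_gt0 (R : realType) (B : set nat) (x : R) :
  infinite_set B -> (2 * increasing_enum B 0)%:R <= x -> (0 < max_rep B x)%N.
Proof.
move=> Binf b0x; apply: leq_trans (rep_count_le_max_rep _ B _ _ b0x).
rewrite cardfs_gt0; apply/fset0Pn; exists (0%N, 0%N).
rewrite in_fset_set ?inE; last exact: finite_reps.
by split => //=; lia.
Qed.

Theorem theorem7 (R : realType) (A B : set nat)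
    (A_infinite : infinite_set A) (B_infinite : infinite_set B)
    (sA_infinite : max_rep A x @[x --> +oo_ R] --> \oo)
    (dAB_infinite : enum_dist A B x @[x --> +oo_ R] --> \oo) :
  (fun x : R => Num.max 1
     ((max_rep A (x - 2 * (enum_dist A B x)%:R))%:R / (enum_dist A B x)%:R) : R)
    =O_ (+oo_ R) (fun x : R => (max_rep B x)%:R : R)
  /\
  (fun x : R => (max_rep B x)%:R : R)
    =O_ (+oo_ R)
  (fun x : R => (max_rep A (x + 2 * (enum_dist A B x)%:R))%:R
                * (enum_dist A B x)%:R : R).
Proof.
have d_gt0 : \forall x \near +oo_ R, (1 <= enum_dist A B x)%N.
  by move/cvgnyPge: dAB_infinite; exact.
split; apply/eqO_exP; exists 5 => //.
- have x_large : \forall x \near +oo_ R, (2 * increasing_enum B 0)%:R <= x.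
    exact: nbhs_pinfty_ge.
  apply: filterS2 d_gt0 x_large => x dx xb.
  have sB_ge1 : 1 <= (max_rep B x)%:R :> R by rewrite ler1n max_rep_gt0.
  rewrite [leRHS](_ : _ = 5 * (max_rep B x)%:R); last by rewrite ger0_norm.
  rewrite ger0_norm ?le_max ?ler01// ge_max; apply/andP; split; first by lra.
  rewrite ler_pdivrMr ?ltr0n// -!natrM ler_nat mulnAC.
  apply: max_rep_perturb => // [t ty|]; last by rewrite natrM subrK.
  apply: enum_dist_ge => //; apply: le_trans ty _.
  by rewrite gerBl.
- apply: filterS d_gt0 => x dx.
  rewrite !ger0_norm ?mulr_ge0// -!natrM ler_nat mulnCA [X in (_ <= X)%N]mulnC.
  apply: max_rep_perturb => // [t tx|]; last by rewrite natrM.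
  by rewrite enum_distC; apply: enum_dist_ge.
Qed.
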